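(* Let $q\ge1$ be an integer and let $G$ be a finite graph with an ordering of its edges and an interaction energy $J_e$ at each edge $e$, equipped with a field vector $\boldsymbol{M}_i=(M_{i,1},\ldots,M_{i,q})\in\mathbb{C}^q$ at each vertex $v_i$. Then the Potts model partition function $Z_{ext}(G)$ with Hamiltonian \[ h(\sigma)=-\sum_{\{i,j\}\in E(G)}J_{i,j}\,\delta(\sigma_i,\sigma_j)-\sum_{v_i\in V(G)}\sum_{\alpha=1}^q M_{i,\alpha}\,\delta(\alpha,\sigma_i) \] admits the spanning forest expansion \[ Z_{ext}(G)=\sum_{F\in\mathcal{F}(G)}X(F)\left(\prod_{e\in F}(\mathrm{e}^{\beta J_e}-1)\right)\left(\prod_{e\in\mathcal{E_A}(G,F)}\mathrm{e}^{\beta J_e}\right), \] where $\mathcal{F}(G)$ is the set of spanning forests of $G$, $\mathcal{E_A}(G,F)$ is the set of externally active edges of $G$ with respect to $F$, and $X(F)=X_{\boldsymbol{F}_1}\cdots X_{\boldsymbol{F}_k}$, where $X_{\boldsymbol{M}}=\sum_{\alpha=1}^q\mathrm{e}^{\beta M_\alpha}$ for $\boldsymbol{M}=(M_1,\ldots,M_q)\in\mathbb{C}^q$, and $\boldsymbol{F}_i$ is the sum of the weights $\boldsymbol{M}_j$ of all of the vertices $v_j$ in the $i$-th component $F_i$ of the spanning forest $F$ (with components $F_1,\ldots,F_k$).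
   Context: Graphs are finite and may have loops and multiple edges; $V(G)=\{v_1,\ldots,v_n\}$. $\beta$ is a fixed constant and each edge $e=\{v_i,v_j\}$ carries an interaction energy $J_e=J_{i,j}$ ($\beta$ and the $J_e$ may be taken to be complex numbers). A state of $G$ is a function $\sigma:V(G)\to\{1,\ldots,q\}$; $\sigma_i=\sigma(v_i)$; $\mathcal{S}(G)$ is the set of states; $\delta$ is the Kronecker delta. $Z_{ext}(G)=\sum_{\sigma\in\mathcal{S}(G)}\mathrm{e}^{-\beta h(\sigma)}$. A spanning forest of $G$ is an acyclic spanning subgraph (vertex set $V(G)$, any acyclic set of edges); it is identified with its edge set when writing $e\in F$. Given an ordering $e_1,\ldots,e_m$ of the edges of $G$ and $F\in\mathcal{F}(G)$, an edge $e\notin F$ is externally active with respect to $F$ if $F\cup e$ contains a cycle (which is then unique) and $e$ is the smallest edge in that cycle. In particular loops are always externally active, and an edge joining two different components of $F$ is not externally active. *)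

(* Defs.v *)
From HB Require Import structures.
From mathcomp Require Import all_boot all_order all_algebra.
From mathcomp Require Import complex.
From mathcomp Require Import boolp reals sequences exp trigo.

Set Implicit Arguments.
Unset Strict Implicit.
Unset Printing Implicit Defensive.

Import Order.TTheory GRing.Theory Num.Theory.
Local Open Scope ring_scope.
Local Open Scope complex_scope.

(* Complex numbers are R[i] with R : realType.  The libraries provide no      *)
(* complex exponential: e^(a + ib) = e^a (cos b + i sin b).                   *)
Definition expC (R : realType) (z : R[i]) : R[i] :=
  let: a +i* b := z in (expR a * cos b) +i* (expR a * sin b).

(* Loops (equal endpoints) and parallel edges (equal values of [ends]) are    *)
(* allowed.  Edges are undirected: the order of the two components of         *)
(* [ends e] is arbitrary and every notion below is symmetric in them.         *)
Record mgraph := MGraph {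
  vertex : finType;
  edge : finType;
  ends : edge -> vertex * vertex }.

Section Graph.
Variable G : mgraph.
Implicit Types (e f : edge G) (F C : {set edge G}) (x y : vertex G).

Definition joins e x y := (ends e == (x, y)) || (ends e == (y, x)).

(* [:: (x_1, e_1); ...; (x_k, e_k)] with k >= 1, distinct vertices x_i and    *)
(* distinct edges e_i, where e_i joins x_i to x_(i+1) and e_k joins x_k to    *)
(* x_1.  Thus k = 1 is a loop and k = 2 a pair of parallel edges.             *)
Definition closed_cycle (s : seq (vertex G * edge G)) : bool :=
  [&& s != [::], uniq (unzip1 s), uniq (unzip2 s)
    & cycle (fun p p' => joins p.2 p.1 p'.1) s].

Definition is_cycle C : Prop :=
  exists2 s, closed_cycle s & C = [set e in unzip2 s].

Definition acyclic F : Prop := forall C, is_cycle C -> ~ C \subset F.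

(* A spanning subgraph is identified with its edge set.                       *)
Definition spanning_forests : {set {set edge G}} :=
  [set F : {set edge G} | `[< acyclic F >]].

Definition adjacent F : rel (vertex G) :=
  fun x y => [exists e in F, joins e x y].

Definition components F : {set {set vertex G}} :=
  equivalence_partition (connect (adjacent F)) [set: vertex G].

(* [es] enumerates the edges and e is smaller than f when it comes first in   *)
(* [es].  If F is a forest, F + e contains at most one cycle, so that the     *)
(* existential designates that cycle.                                         *)
Definition externally_active (es : seq (edge G)) F e : Prop :=
  e \notin F /\
  exists C, [/\ is_cycle C, C \subset e |: F, e \in C
              & {in C, forall f, (index e es <= index f es)%N}].

Definition ext_active_edges (es : seq (edge G)) F : {set edge G} :=
  [set e | `[< externally_active es F e >]].

End Graph.

Section Potts.
Variables (R : realType) (q : nat) (G : mgraph).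
Variables (beta : R[i]) (J : edge G -> R[i]) (M : vertex G -> 'rV[R[i]]_q).

Definition state := {ffun vertex G -> 'I_q}.

Definition kronecker (T : eqType) (a b : T) : R[i] := (a == b)%:R.

Definition hamiltonian (s : state) : R[i] :=
  - \sum_(e : edge G) J e * kronecker (s (ends e).1) (s (ends e).2)
  - \sum_(v : vertex G) \sum_(a < q) M v 0 a * kronecker a (s v).

Definition Z_ext : R[i] := \sum_(s : state) expC (- beta * hamiltonian s).

Definition X_vec (W : 'rV[R[i]]_q) : R[i] := \sum_(a < q) expC (beta * W 0 a).

Definition X_forest (F : {set edge G}) : R[i] :=
  \prod_(B in components F) X_vec (\sum_(v in B) M v).

End Potts.

(* Main.v *)
(* Expanding each factor 1 + (e^(beta J_e) - 1) delta(sigma_i, sigma_j) of    *)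
(* the Boltzmann weights and summing over the states gives the sum over all   *)
(* edge sets A of X(A) \prod_(e in A) (e^(beta J_e) - 1), where X(A) depends  *)
(* only on the components of A.  Inside A, the edges whose endpoints are not  *)
(* connected by larger edges of A form a spanning forest with the same        *)
(* components as A.  The edge sets A that yield a given forest F are those    *)
(* with F <= A <= F u EA(F), so the part A \ F contributes a factor           *)
(* 1 + (e^(beta J_e) - 1) for every externally active edge.                   *)
From HB Require Import structures.
From mathcomp Require Import all_boot all_order all_algebra.
From mathcomp Require Import complex.
From mathcomp Require Import boolp reals sequences exp trigo.
From mathcomp Require Import ring.
Require Import Defs.

Set Implicit Arguments.
Unset Strict Implicit.
Unset Printing Implicit Defensive.

Import GRing.Theory.
Local Open Scope ring_scope.

(** The partition function becomes a sum over edge sets ([random_cluster_expansion]), which is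
    grouped along the retraction [kernel] onto spanning forests. This map preserves components
    ([components_kernel]), hence the factor X, and its fibre over [F] is an interval of edge sets
    ([kernelE]), on which the sum factors edge by edge ([kernel_fibre_sum]). External activity
    enters through [ext_active_linked], which trades cycles for connectivity by larger edges, the
    criterion that also defines [kernel]. *)

Section Graph.
Variable G : mgraph.
Implicit Types (e f : edge G) (A B C F H : {set edge G}) (x y : vertex G).

Definition linked F e := connect (adjacent F) (ends e).1 (ends e).2.

Lemma joinsC e x y : joins e x y = joins e y x.
Proof. by rewrite /joins orbC. Qed.

Lemma joins_ends e : joins e (ends e).1 (ends e).2.
Proof. by rewrite /joins -surjective_pairing eqxx. Qed.

Lemma connect_adjacentC F : connect_sym (adjacent F).
Proof.
by apply: sym_connect_sym => x y; apply: eq_existsb => e; rewrite joinsC.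
Qed.

Lemma linkedP F e x y : joins e x y -> linked F e = connect (adjacent F) x y.
Proof.
by rewrite /joins /linked => /orP[] /eqP -> //=; rewrite connect_adjacentC.
Qed.

Lemma linked_in F e : e \in F -> linked F e.
Proof.
by move=> Fe; apply/connect1/existsP; exists e; rewrite Fe joins_ends.
Qed.

(** Each edge of a path in [A] is replaced by a path in [B]. Most comparisons of connectivity below
    reduce to this. *)
Lemma connect_adjacent_sub A B :
  {in A, forall e, linked B e} ->
  subrel (connect (adjacent A)) (connect (adjacent B)).
Proof.
move=> AB; apply: connect_sub => x y /existsP[e /andP[Ae exy]].
by rewrite -(linkedP _ exy) AB.
Qed.

Lemma linkedS A B e : A \subset B -> linked A e -> linked B e.
Proof.
move=> /subsetP AB; apply: connect_adjacent_sub => f /AB; exact: linked_in.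
Qed.

(** * Cycles and connectivity avoiding an edge *)

Definition walk_step (p p' : vertex G * edge G) := joins p.2 p.1 p'.1.

Lemma connect_walk H s p p0 :
  path walk_step p (rcons s p0) -> {subset unzip2 (p :: s) <= H} ->
  connect (adjacent H) p.1 p0.1.
Proof.
elim: s p => [|p1 s IHs] p /= /andP[pp1 ps] sub.
  by apply/connect1/existsP; exists p.2; rewrite sub ?inE ?eqxx.
apply: (@connect_trans _ _ p1.1).
  by apply/connect1/existsP; exists p.2; rewrite sub ?inE ?eqxx.
by apply: IHs => // f fs; apply: sub; rewrite inE fs orbT.
Qed.

(** The rest of the cycle runs between the ends of [e]; the cycle is first rotated to start at
    [e]. *)
Lemma cycle_linked C e : is_cycle C -> e \in C -> linked (C :\ e) e.
Proof.
move=> [s sP ->]; rewrite inE => /mapP[p ps ->] {e}.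
case: (rot_to ps) => i s' rot_s.
have {}sP : closed_cycle (p :: s').
  rewrite -rot_s /closed_cycle /unzip1 /unzip2 !map_rot !rot_uniq rot_cycle.
  by move: sP; rewrite /closed_cycle -!size_eq0 size_rot.
have -> : [set e in unzip2 s] = [set e in unzip2 (p :: s')].
  by apply/setP => e; rewrite -rot_s !inE /unzip2 map_rot mem_rot.
case/and4P: sP => _ _ /= /andP[pNs' _] cs.
have sub : {subset unzip2 s' <= [set e in unzip2 (p :: s')] :\ p.2}.
  move=> f fs'; rewrite !inE fs' orbT andbT.
  by apply: contraNneq pNs' => <-.
(* A cycle of length one is a loop, whose ends are linked by the empty path. *)
case: s' => [|p1 s'] in cs pNs' sub {rot_s} *.
  by move: cs; rewrite /= andbT => pp; rewrite (linkedP _ pp) connect0.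
case/andP: cs => pp1 ps1; rewrite (linkedP _ pp1) connect_adjacentC.
exact: (connect_walk ps1).
Qed.

(* Simplicity of the vertex path forces distinct edges: the first edge has    *)
(* the starting point as an endpoint, whereas the later ones avoid it.        *)
Lemma simple_path_walk H x p :
  path (adjacent H) x p -> uniq (x :: p) ->
  exists s : seq (vertex G * edge G),
    [/\ unzip1 s = belast x p, uniq (unzip2 s), {subset unzip2 s <= H},
        {in unzip2 s, forall f u v, joins f u v -> u \in x :: p}
      & forall p0 pn, joins p0.2 p0.1 x -> pn.1 = last x p ->
          path walk_step p0 (rcons s pn)].
Proof.
elim: p x => [|y p IHp] x.
  move=> _ _; exists [::]; split => // p0 pn st pn1.
  by rewrite /= /walk_step pn1 /= andbT.
move=> /= /andP[/existsP[f /andP[Hf fxy]] yp] /andP[xyp uyp].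
have [s [s1 s2 sH sin sw]] := IHp y yp uyp.
exists ((x, f) :: s); split => /=.
- by rewrite s1.
- rewrite s2 andbT; apply/negP => fs; move: xyp.
  by rewrite (sin f fs x y fxy).
- by move=> g; rewrite inE => /predU1P[-> //|/sH].
- move=> g; rewrite inE => /predU1P[->|gs] u v.
    move: fxy; rewrite /joins => /orP[] /eqP -> /orP[] /eqP[? ?]; subst u v;
    by rewrite !inE eqxx ?orbT.
  by move=> /(sin g gs) uyp'; rewrite inE uyp' orbT.
- by move=> p0 pn st pn1; rewrite {1}/walk_step st /= sw.
Qed.

Lemma linked_cycle H e : e \notin H -> linked H e ->
  exists C, [/\ is_cycle C, C \subset e |: H & e \in C].
Proof.
move=> eNH /connectP[p0 p0P]; case: (shortenP p0P) => p pP up _ lastp.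
have [s [s1 s2 sH _ sw]] := simple_path_walk pP up.
exists [set f in unzip2 (((ends e).2, e) :: s)]; split.
(* The cycle crosses [e] from its second end to its first, then returns along the simple path. As
   [s] leaves out the last vertex of that path, no vertex is repeated; a loop gives an empty [s]. *)
- exists (((ends e).2, e) :: s) => //; apply/and4P; split => //=.
  + by rewrite s1 lastp -rcons_uniq -lastI.
  + by rewrite s2 andbT; apply: contra eNH => /sH.
  + by apply: sw => //; rewrite /= joinsC joins_ends.
- apply/subsetP => f; rewrite !inE => /predU1P[->|/sH ->].
    by rewrite eqxx.
  by rewrite orbT.
- by rewrite !inE eqxx.
Qed.

Lemma acyclic_linked F e : acyclic F -> e \in F -> ~~ linked (F :\ e) e.
Proof.
move=> Fac Fe; apply/negP => /linked_cycle; rewrite !inE eqxx /= => /(_ isT).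
by case=> C [Cc CF _]; apply: (Fac C Cc); rewrite -(setD1K Fe).
Qed.

(** * Kruskal's forest and external activity *)

Variable es : seq (edge G).
Hypothesis es_order : perm_eq es (enum (edge G)).

Definition above A e : {set edge G} :=
  [set f in A | (index e es < index f es)%N].

(* The forest that Kruskal's algorithm selects in [A] when it processes the   *)
(* edges from the largest to the smallest.                                    *)
Definition kernel A : {set edge G} :=
  [set e in A | ~~ linked (above A e) e].

Lemma mem_order e : e \in es.
Proof. by rewrite (perm_mem es_order) mem_enum. Qed.

Lemma index_order_inj : injective (fun e => index e es).
Proof. by move=> e f /(index_inj e); apply; exact: mem_order. Qed.

Lemma aboveS A B e : A \subset B -> above A e \subset above B e.
Proof.
by move=> /subsetP AB; apply/subsetP => f; rewrite !inE => /andP[/AB -> ->].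
Qed.

Lemma above_sub A e : above A e \subset A.
Proof. by apply/subsetP => f; rewrite inE => /andP[]. Qed.

Lemma above_subD1 A e : above A e \subset A :\ e.
Proof.
apply/subsetP => f; rewrite !inE => /andP[-> lt_ef]; rewrite andbT.
by apply: contraTneq lt_ef => ->; rewrite ltnn.
Qed.

Lemma linked_above_trans A B e :
  {in above A e, forall f, linked (above B e) f} ->
  linked (above A e) e -> linked (above B e) e.
Proof. by move=> AB; apply: connect_adjacent_sub. Qed.

Lemma kernel_sub A : kernel A \subset A.
Proof. by apply/subsetP => f; rewrite inE => /andP[]. Qed.

(** Induction from the largest edge down: an edge rejected by [kernel] is bypassed by larger edges
    of [A], themselves linked in the kernel. The bound [e] stays fixed throughout. *)
Lemma linked_above_kernel A e f :
  f \in A -> (index e es < index f es)%N -> linked (above (kernel A) e) f.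
Proof.
have [n] := ubnP (size es - index f es).
elim: n f => // n IHn f le_n Af lt_ef.
have [/linked_in//|] := boolP (f \in above (kernel A) e).
rewrite inE lt_ef andbT inE Af /= negbK; apply: connect_adjacent_sub => g.
rewrite inE => /andP[Ag lt_fg]; apply: IHn => //; last exact: ltn_trans lt_fg.
apply: leq_trans (le_n : _ <= n)%N; rewrite ltn_sub2l //.
by rewrite index_mem mem_order.
Qed.

Lemma linked_kernel A e : e \in A -> linked (kernel A) e.
Proof.
move=> Ae; have [/linked_in//|] := boolP (e \in kernel A).
rewrite inE Ae /= negbK; apply: connect_adjacent_sub => f.
rewrite inE => /andP[Af lt_ef].
exact: linkedS (above_sub _ _) (linked_above_kernel Af lt_ef).
Qed.

(** Positions in [es] are distinct, so the rest of the cycle lies strictly above its minimum. *)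
Lemma cycle_min_linked C e : is_cycle C -> e \in C ->
  {in C, forall f, (index e es <= index f es)%N} -> linked (above C e) e.
Proof.
move=> Cc Ce Cmin; apply: linkedS (cycle_linked Cc Ce).
apply/subsetP => f; rewrite !inE => /andP[fe Cf].
rewrite Cf ltn_neqAle Cmin // andbT.
by apply: contra fe => /eqP /index_order_inj ->.
Qed.

(** The smallest edge of a cycle is bypassed by the larger ones, so [kernel] would have rejected
    it. *)
Lemma kernel_acyclic A : acyclic (kernel A).
Proof.
move=> C Cc CK; have [e0 Ce0] : exists e, e \in C.
  case: (Cc) => -[//|p s] _ ->; exists p.2; rewrite inE /=.
  by rewrite inE eqxx.
case: (arg_minnP (fun e => index e es) Ce0) => e Ce Cmin.
have := subsetP CK e Ce; rewrite inE => /andP[_ /negP]; apply.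
apply: linkedS (cycle_min_linked Cc Ce Cmin).
exact: aboveS (subset_trans CK (kernel_sub A)).
Qed.

Lemma ext_active_linked F e :
  (e \in ext_active_edges es F) = (e \notin F) && linked (above F e) e.
Proof.
rewrite inE; apply/asboolP/andP => [[eNF [C [Cc CF Ce Cmin]]]|[eNF lke]].
  split=> //; apply: linkedS (cycle_min_linked Cc Ce Cmin).
  apply/subsetP => f; rewrite !inE => /andP[Cf lt_ef]; rewrite lt_ef andbT.
  have := subsetP CF f Cf; rewrite !inE => /predU1P[fe|//].
  by rewrite fe ltnn in lt_ef.
(* Closing a path of larger edges by [e] gives a cycle whose minimum is automatically [e]. *)
split=> //; have eNa : e \notin above F e by rewrite inE ltnn andbF.
have [C [Cc CF Ce]] := linked_cycle eNa lke.
exists C; split=> //; first by apply: subset_trans CF (setUS _ (above_sub _ _)).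
by move=> f /(subsetP CF); rewrite !inE => /predU1P[->//|/andP[_ /ltnW]].
Qed.

Lemma kernelE A F : acyclic F ->
  (kernel A == F) = (F \subset A) && (A \subset F :|: ext_active_edges es F).
Proof.
move=> Fac; apply/eqP/andP => [<-|[FA AFE]].
  split; first exact: kernel_sub.
  apply/subsetP => e Ae; rewrite in_setU ext_active_linked.
  have [//|eNK /=] := boolP (e \in kernel A); move: eNK.
  rewrite inE Ae /= negbK; apply: linked_above_trans => f.
  by rewrite inE => /andP[Af lt_ef]; apply: linked_above_kernel.
(* The edges of [A] outside [F] are active, so each is bypassed by still larger edges of [F]: [A]
   and [F] pass the same test at every [e]. Acyclicity then keeps the edges of [F], and activity
   rejects the others. *)
have lkA e : linked (above A e) e = linked (above F e) e.
  apply/idP/idP; last by apply: linkedS; apply: aboveS.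
  apply: linked_above_trans => f; rewrite inE => /andP[Af lt_ef].
  have := subsetP AFE f Af; rewrite in_setU ext_active_linked.
  have [Ff _|_ /=] := boolP (f \in F); first by rewrite linked_in // inE Ff.
  apply: linkedS; apply/subsetP => g; rewrite !inE => /andP[-> /=].
  exact: ltn_trans.
apply/setP => e; rewrite inE lkA; have [Fe|eNF] := boolP (e \in F).
  rewrite (subsetP FA) //=; apply: contra (acyclic_linked Fac Fe).
  exact: linkedS (above_subD1 _ _).
have [/(subsetP AFE)|//] := boolP (e \in A).
by rewrite in_setU ext_active_linked (negPf eNF) /= => ->.
Qed.

(** A discarded edge still has its ends linked in the kernel. This makes X constant on the
    fibres. *)
Lemma components_kernel A : components (kernel A) = components A.
Proof.
apply: eq_imset => x; apply/setP => y; rewrite !inE.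
apply/idP/idP; apply: connect_adjacent_sub => e.
  by move=> /(subsetP (kernel_sub A)); apply: linked_in.
exact: linked_kernel.
Qed.

(** * Components as a partition, and states constant on blocks *)

Lemma connect_equivalence F : equivalence_rel (connect (adjacent F)).
Proof.
apply/equivalence_relP; split=> [x | x y]; first exact: connect0.
exact/same_connect/connect_adjacentC.
Qed.

Lemma components_partition F : partition (components F) [set: vertex G].
Proof.
by apply: equivalence_partitionP => x y z _ _ _; apply: connect_equivalence.
Qed.

Lemma pblock_components F x y :
  (y \in pblock (components F) x) = connect (adjacent F) x y.
Proof.
by apply: pblock_equivalence_partition; rewrite ?inE // => u v w _ _ _;
   apply: connect_equivalence.
Qed.

End Graph.

(** Distributing the product chooses one value per block, which amounts to a state constant on
    blocks. *)
Lemma prod_const_on_partition (K : comNzRingType) (V : finType) (q : nat)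
    (q_gt0 : (0 < q)%N) (P : {set {set V}}) (y : V -> 'I_q -> K) :
    partition P [set: V] ->
  \prod_(B in P) \sum_(a < q) \prod_(v in B) y v a =
  \sum_(s : {ffun V -> 'I_q} | [forall v, forall w in pblock P v, s v == s w])
    \prod_v y v (s v).
Proof.
move=> partP; have [/eqP coverP trivP P0] := and3P partP.
have inP v : pblock P v \in P by rewrite pblock_mem // coverP inE.
have in_pblock v : v \in pblock P v by rewrite mem_pblock coverP inE.
(* The choice functions live on all sets of vertices and must equal the default [a0] outside [P];
   [h'] respects this convention. *)
pose a0 := Ordinal q_gt0; rewrite (big_distr_big a0) /=.
pose h (g : {ffun {set V} -> 'I_q}) : {ffun V -> 'I_q} :=
  [ffun v => g (pblock P v)].
pose h' (s : {ffun V -> 'I_q}) : {ffun {set V} -> 'I_q} :=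
  [ffun B => if B \in P then oapp s a0 [pick v in B] else a0].
rewrite [RHS](reindex_onto h h'); last first.
  move=> s /forallP s_const; apply/ffunP => v; rewrite !ffunE inP.
  case: pickP => [w vw | /(_ v)]; last by rewrite in_pblock.
  by have /forall_inP/(_ w vw)/eqP -> := s_const v.
apply: eq_big => [g | g _]; last first.
  rewrite [RHS](eq_bigl (mem [set: V])) => [|v]; last by rewrite /= inE.
  rewrite [RHS](set_partition_big _ partP) /=; apply: eq_bigr => B PB.
  apply: eq_bigr => v Bv; by rewrite ffunE (def_pblock trivP PB Bv).
have -> : [forall v, forall w in pblock P v, h g v == h g w].
  apply/forallP => v; apply/forall_inP => w vw.
  by rewrite !ffunE (same_pblock trivP vw).
apply/pffun_onP/eqP => [[/subsetP supp _] | <-].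
  apply/ffunP => B; rewrite ffunE; case: ifPn => [PB | PB]; last first.
    by apply/esym/eqP; apply: contraNT PB => /supp.
  case: pickP => [v Bv | B0] /=.
    by rewrite ffunE (def_pblock trivP PB Bv).
  by case/negP: P0; rewrite -(_ : B = set0) //; apply/setP => v; rewrite B0 inE.
split=> //; apply/subsetP => B; rewrite inE ffunE.
by case: ifP; rewrite ?eqxx.
Qed.

(** * Random-cluster and forest expansions *)

Section Expansion.
Variables (K : comNzRingType) (G : mgraph).
Implicit Types (A F : {set edge G}) (w : edge G -> K).

Lemma const_on_components q F (s : {ffun vertex G -> 'I_q}) :
  [forall v, forall u in pblock (components F) v, s v == s u] =
  [forall e in F, s (ends e).1 == s (ends e).2].
Proof.
apply/forallP/forall_inP => [s_const e Fe | s_const v].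
  apply: (forall_inP (s_const (ends e).1)); rewrite pblock_components.
  exact: linked_in.
apply/forall_inP => u; rewrite pblock_components => /connectP[p].
elim: p v => [|x p IHp] v /=; first by move=> _ ->.
move=> /andP[/existsP[e /andP[Fe evx]] xp] /(IHp x xp) /eqP <-.
by have := s_const e Fe; case/orP: evx => /eqP -> /= /eqP ->.
Qed.

Lemma random_cluster_expansion q (q_gt0 : (0 < q)%N) w
    (y : vertex G -> 'I_q -> K) :
  \sum_(s : {ffun vertex G -> 'I_q})
    (\prod_e (w e *+ (s (ends e).1 == s (ends e).2) + 1)) * \prod_v y v (s v) =
  \sum_A (\prod_(B in components A) \sum_(a < q) \prod_(v in B) y v a)
         * \prod_(e in A) w e.
Proof.
under eq_bigr => s _ do rewrite bigA_distr mulr_suml.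
rewrite exchange_big; apply: eq_bigr => A _ /=.
rewrite (prod_const_on_partition q_gt0 _ (components_partition A)).
rewrite mulr_suml [RHS]big_mkcond; apply: eq_bigr => s _.
rewrite const_on_components -big_mkcond /=.
case: ifPn => [/forall_inP s_const | ].
  rewrite mulrC; congr (_ * _); apply: eq_bigr => e Ae.
  by rewrite s_const // mulr1n.
(* A state that differs across an edge of [A] contributes a zero factor. *)
rewrite negb_forall_in => /exists_inP[e Ae /negPf sNe].
by rewrite (bigD1 e) //= sNe mulr0n !mul0r.
Qed.

Lemma kernel_fibre_sum es (es_order : perm_eq es (enum (edge G))) F w :
  acyclic F ->
  \sum_(A | kernel es A == F) \prod_(e in A) w e =
  (\prod_(e in F) w e) * \prod_(e in ext_active_edges es F) (w e + 1).
Proof.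
move=> Fac; pose E := ext_active_edges es F.
have disj e : e \in F -> e \in E = false.
  by move=> Fe; rewrite ext_active_linked // Fe.
(* Each summand is the weight of having [e] in or out of [A], set to 0 when that choice leaves the
   interval from [F] to [F :|: E]; distributing therefore sums over the fibre. *)
transitivity (\prod_e ((if e \in F :|: E then w e else 0)
                       + (if e \in F then 0 else 1))); last first.
  rewrite [X in X * _]big_mkcond [X in _ * X]big_mkcond -big_split /=.
  apply: eq_bigr => e _; rewrite in_setU; have [Fe|_] /= := boolP (e \in F).
    by rewrite disj // addr0 mulr1.
  by rewrite mul1r; case: ifP => // _; rewrite add0r.
rewrite bigA_distr big_mkcond; apply: eq_bigr => A _ /=.
rewrite (kernelE es_order _ Fac).
have [FA|/subsetPn[e Fe eNA]] := boolP (F \subset A); last first.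
  by rewrite /= (bigD1 e) //= (negPf eNA) Fe mul0r.
have [AFE|/subsetPn[e Ae eNFE]] := boolP (A \subset F :|: E); last first.
  by rewrite /= (bigD1 e) //= Ae (negPf eNFE) mul0r.
rewrite big_mkcond; apply: eq_bigr => e _; case: ifPn => [Ae | eNA].
  by rewrite (subsetP AFE).
by rewrite (negPf (contra (subsetP FA e) eNA)).
Qed.

Lemma forest_expansion es (es_order : perm_eq es (enum (edge G))) w
    (X : {set edge G} -> K) : (forall A, X (kernel es A) = X A) ->
  \sum_A X A * \prod_(e in A) w e =
  \sum_(F in spanning_forests G) X F * (\prod_(e in F) w e)
     * \prod_(e in ext_active_edges es F) (w e + 1).
Proof.
move=> X_kernel.
rewrite (partition_big (kernel es) (mem (spanning_forests G))) => [|A _].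
  apply: eq_bigr => F /=; rewrite inE => /asboolP Fac.
  rewrite -mulrA -kernel_fibre_sum // mulr_sumr.
  by apply: eq_bigr => A /eqP <-; rewrite X_kernel.
by rewrite /= inE; apply/asboolP; apply: kernel_acyclic.
Qed.

End Expansion.

(** * The complex exponential and the Potts weights *)

Section ComplexExponential.
Variable R : realType.
Implicit Types z : R[i].

Lemma expC0 : expC 0 = 1 :> R[i].
Proof.
by apply/eqP; rewrite eq_complex /= expR0 cos0 sin0 mulr0 mulr1 !eqxx.
Qed.

Lemma expCD : {morph @expC R : z1 z2 / z1 + z2 >-> z1 * z2}.
Proof.
move=> [a1 b1] [a2 b2]; apply/eqP; rewrite eq_complex /= expRD cosD sinD.
by apply/andP; split; apply/eqP; ring.
Qed.

Lemma expC_sum (I : Type) (r : seq I) (P : pred I) (F : I -> R[i]) :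
  expC (\sum_(i <- r | P i) F i) = \prod_(i <- r | P i) expC (F i).
Proof. exact: (big_morph _ expCD expC0). Qed.

End ComplexExponential.

(** Since the delta is 0 or 1, an edge factor is affine in it; in the field term only the spin of
    the vertex survives. *)
Lemma boltzmann_weight (R : realType) (q : nat) (G : mgraph) (beta : R[i])
    (J : edge G -> R[i]) (M : vertex G -> 'rV[R[i]]_q) (s : state q G) :
  expC (- beta * hamiltonian J M s) =
  (\prod_e ((expC (beta * J e) - 1) *+ (s (ends e).1 == s (ends e).2) + 1))
  * \prod_v expC (beta * M v 0 (s v)).
Proof.
rewrite /hamiltonian -opprD mulrNN mulrDr expCD !mulr_sumr !expC_sum.
congr (_ * _); apply: eq_bigr => x _.
  rewrite /kronecker; case: eqP => _; first by rewrite mulr1 mulr1n subrK.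
  by rewrite !mulr0 expC0 mulr0n add0r.
rewrite (bigD1 (s x)) //= big1 => [|a /negPf sxa].
  by rewrite /kronecker eqxx mulr1 addr0.
by rewrite /kronecker sxa mulr0.
Qed.

(** The exponential turns the summed field of a component into a product over its vertices, the form
    produced by [random_cluster_expansion]. *)
Lemma X_forestE (R : realType) (q : nat) (G : mgraph) (beta : R[i])
    (M : vertex G -> 'rV[R[i]]_q) (F : {set edge G}) :
  X_forest beta M F =
  \prod_(B in components F) \sum_(a < q) \prod_(v in B) expC (beta * M v 0 a).
Proof.
apply: eq_bigr => B _; apply: eq_bigr => a _.
by rewrite summxE mulr_sumr expC_sum.
Qed.

Theorem theorem3p2 (R : realType) (q : nat) (q_ge1 : (1 <= q)%N) (G : mgraph)
    (es : seq (edge G)) (es_order : perm_eq es (enum (edge G)))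
    (beta : R[i]) (J : edge G -> R[i]) (M : vertex G -> 'rV[R[i]]_q) :
  Z_ext beta J M =
  \sum_(F in spanning_forests G)
    X_forest beta M F
    * (\prod_(e in F) (expC (beta * J e) - 1))
    * (\prod_(e in ext_active_edges es F) expC (beta * J e)).
Proof.
rewrite /Z_ext; under eq_bigr => s _ do rewrite boltzmann_weight.
rewrite (random_cluster_expansion q_ge1 (fun e => expC (beta * J e) - 1)
           (fun v a => expC (beta * M v 0 a))).
under eq_bigr => A _ do rewrite -X_forestE.
rewrite (forest_expansion es_order) => [|A]; last first.
  by rewrite /X_forest components_kernel.
by apply: eq_bigr => F _; congr (_ * _); apply: eq_bigr => e _; rewrite subrK.
Qed.
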